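(* Let $\Gamma_c$ be a finite connected graph with $n$ vertices and $m\ge 1$ edges, and let $\mathcal S$, $\tau$, $\delta_t,\delta_s,\mathcal D$ be the matrices defined in the context, acting on $x\in\mathbb C^{2m}$ (functions on oriented edges). (A) If $\mathcal{S}x = x$ and $\tau x = x$, then $x$ is a multiple of the constant vector ${\bf 1} = (1,1,\dots,1)$. (B) If $\mathcal{S}x = x$ and $x \perp {\bf 1}$, then $\tau x = -x$. (C) The fixed points of $\mathcal{S}$ are harmonic $1$-forms, in the sense that $\mathcal Sx=x$ implies $$(\delta_t -\delta_s)\, \mathcal{D}^{-1}(\delta^*_t - \delta^*_s)\, x = 0.$$ (D) There are $\beta_1 := m-n+1$ linearly independent harmonic $1$-forms (solutions of the equation displayed in (C)) such that $\tau x = -x$; that is, the space of these has dimension $\beta_1$. (E) Let $\{\mathcal{C}_j: 1 \le j \le \beta_1\}$ be a set of cycles in $\Gamma_c$ that are independent generators of the fundamental group of $\Gamma_c$. Then the space of fixed vectors $x$ of $\mathcal{S}$ with $\tau x = -x$ has a basis $x^{(1)},\dots,x^{(\beta_1)}$ with $x^{(j)}$ supported on $\mathcal{C}_j$. These vectors can be normalized to have the following explicit form: if $\mathcal C_j$ is oriented as a sequence of consecutive oriented edges ${\bf e}_1,\dots,{\bf e}_k$, then $x^{(j)}({\bf e}_\ell)=1$ and $x^{(j)}(-{\bf e}_\ell)=-1$ for $\ell=1,\dots,k$, and $x^{(j)}$ vanishes on all oriented edges not in $\mathcal C_j$.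
   Context: Each edge of $\Gamma_c$ gives rise to two oriented edges, ${\bf e}$ and its reversal $-{\bf e}$, so there are $2m$ oriented edges. The oriented edge ${\bf e}$ has source vertex $s({\bf e})$ and terminal vertex $t({\bf e})$, with $s(-{\bf e})=t({\bf e})$ and $t(-{\bf e})=s({\bf e})$. The degree $d_v$ is the number of oriented edges with terminal vertex $v$. $\delta_t^*$ is the $n\times 2m$ matrix with $(\delta_t^* )_{t({\bf e}),{\bf e}}=1$ and all other entries $0$; $\delta_s^*$ is the $n\times 2m$ matrix with $(\delta_s^* )_{s({\bf e}),{\bf e}}=1$ and all other entries $0$; $\delta_t,\delta_s$ are their adjoints. $\mathcal D=\operatorname{diag}(d_v)=\delta_t^*\delta_t=\delta_s^*\delta_s$. $\tau$ is the $2m\times2m$ permutation matrix of the edge reversal ${\bf e}\mapsto-{\bf e}$. The bond-scattering matrix $\mathcal S$ is the $2m\times 2m$ matrix with $\mathcal S_{{\bf e}'{\bf e}}=0$ unless $t({\bf e})=s({\bf e}')$; if $t({\bf e})=s({\bf e}')$ and ${\bf e}'\neq-{\bf e}$, then $\mathcal S_{{\bf e}'{\bf e}}=\frac{2}{d_{t({\bf e})}}$; and $\mathcal S_{-{\bf e}\,{\bf e}}=\frac{2}{d_{t({\bf e})}}-1$. A cycle is a closed walk $v_1\to v_2\to\cdots\to v_k\to v_1$ with distinct vertices and distinct edges. *)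

(* Defs.v *)
From HB Require Import structures.
From mathcomp Require Import all_boot all_order all_algebra.
From mathcomp Require Import complex.
From mathcomp Require Import reals.

Set Implicit Arguments.
Unset Strict Implicit.
Unset Printing Implicit Defensive.

Import Order.TTheory GRing.Theory Num.Theory.
Local Open Scope ring_scope.
Local Open Scope sesquilinear_scope.

(* A finite graph with n vertices and m edges, given by its 2m oriented edges:
   an edge is a pair {e, erev e}.  Loops and multiple edges are allowed; a
   simple graph is the special case where (src, tgt) is injective and
   src e != tgt e. *)
Record graph (n m : nat) := Graph {
  src : 'I_(2 * m) -> 'I_n;
  erev : 'I_(2 * m) -> 'I_(2 * m);
  erevK : involutive erev;
  erev_neq : forall e, erev e != e
}.

Section Graph.
Variables (n m : nat) (G : graph n m).
Notation dart := 'I_(2 * m).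

Definition tgt (e : dart) : 'I_n := src G (erev G e).

Definition degree (v : 'I_n) : nat := #|[set e : dart | tgt e == v]|.

Definition adjacent : rel 'I_n :=
  fun u v => [exists e : dart, (src G e == u) && (tgt e == v)].

Definition connected_graph : Prop := forall u v, connect adjacent u v.

(* As a natural number; a connected graph has n <= m + 1, so the truncated
   subtraction is then the true value of m - n + 1. *)
Definition betti1 : nat := (m + 1 - n)%N.

Fixpoint walk (u : 'I_n) (p : seq dart) (v : 'I_n) : bool :=
  if p is e :: q then (src G e == u) && walk (tgt e) q v else u == v.

Definition walk_inv (p : seq dart) : seq dart := rev (map (erev G) p).

(* The last condition says that the underlying unoriented edges are pairwise
   distinct. *)
Definition is_cycle (c : seq dart) : Prop :=
  [/\ c != [::],
      cycle (fun e f => tgt e == src G f) c,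
      uniq (map (src G) c) &
      uniq (c ++ map (erev G) c)].

(* Homotopy of walks from u to v relative to the end points.  The classes of
   closed walks at v0 form the fundamental group pi_1(G, v0), with
   concatenation as product, walk_inv as inverse and [::] as unit. *)
Inductive homotopic (u v : 'I_n) : seq dart -> seq dart -> Prop :=
| homotopic_refl p of walk u p v : homotopic u v p p
| homotopic_backtrack p e q of walk u (p ++ [:: e, erev G e & q]) v :
    homotopic u v (p ++ [:: e, erev G e & q]) (p ++ q)
| homotopic_sym p q of homotopic u v p q : homotopic u v q p
| homotopic_trans p q r of homotopic u v p q & homotopic u v q r :
    homotopic u v p r.

(* Words in k letters and their formal inverses: (j, true) stands for the
   inverse of the letter j. *)
Definition word_eval k (g : 'I_k -> seq dart) (w : seq ('I_k * bool)) :
    seq dart :=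
  flatten [seq if a.2 then walk_inv (g a.1) else g a.1 | a <- w].

Definition reduced_word k (w : seq ('I_k * bool)) : bool :=
  sorted (fun a b => ~~ ((a.1 == b.1) && (a.2 != b.2))) w.

Definition generates_pi1 (v0 : 'I_n) k (g : 'I_k -> seq dart) : Prop :=
  forall p, walk v0 p v0 -> exists w, homotopic v0 v0 p (word_eval g w).

Definition independent_in_pi1 (v0 : 'I_n) k (g : 'I_k -> seq dart) : Prop :=
  forall w, reduced_word w -> homotopic v0 v0 (word_eval g w) [::] ->
    w = [::].

(* Cycles need not pass through a common vertex, so each one is turned into a
   closed walk at a base vertex v0 by means of a connecting walk. *)
Definition independent_generators k (c : 'I_k -> seq dart) : Prop :=
  exists (v0 : 'I_n) (p : 'I_k -> seq dart),
    let g j := p j ++ c j ++ walk_inv (p j) in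
    [/\ forall j, walk v0 (g j) v0,
        generates_pi1 v0 g &
        independent_in_pi1 v0 g].

Variable C : numClosedFieldType.

Definition delta_t_star : 'M[C]_(n, 2 * m) := \matrix_(v, e) (v == tgt e)%:R.
Definition delta_s_star : 'M[C]_(n, 2 * m) := \matrix_(v, e) (v == src G e)%:R.
Definition delta_t : 'M[C]_(2 * m, n) := delta_t_star ^t*.
Definition delta_s : 'M[C]_(2 * m, n) := delta_s_star ^t*.

Definition degree_mx : 'M[C]_n := diag_mx (\row_v (degree v)%:R).

Definition tau : 'M[C]_(2 * m) := \matrix_(e', e) (e' == erev G e)%:R.

Definition bond_scattering : 'M[C]_(2 * m) :=
  \matrix_(e', e)
    if tgt e == src G e' then
      if e' == erev G e then 2 / (degree (tgt e))%:R - 1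
      else 2 / (degree (tgt e))%:R
    else 0.

Definition harmonic_op : 'M[C]_(2 * m) :=
  (delta_t - delta_s) *m invmx degree_mx *m (delta_t_star - delta_s_star).

Definition harmonic_space : {vspace 'cV[C]_(2 * m)} :=
  lker (linfun (mulmx harmonic_op)).

Definition fixed_space : {vspace 'cV[C]_(2 * m)} :=
  passmx.leigenspace (linfun (mulmx bond_scattering)) 1.

Definition odd_space : {vspace 'cV[C]_(2 * m)} :=
  passmx.leigenspace (linfun (mulmx tau)) (-1).

Lemma mem_harmonic_space (x : 'cV[C]_(2 * m)) :
  (x \in harmonic_space) = (harmonic_op *m x == 0).
Proof. by rewrite memv_ker lfunE. Qed.

Lemma mem_fixed_space (x : 'cV[C]_(2 * m)) :
  (x \in fixed_space) = (bond_scattering *m x == x).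
Proof.
by rewrite memv_ker add_lfunE opp_lfunE scale_lfunE id_lfunE lfunE /=
  scale1r subr_eq0.
Qed.

Lemma mem_odd_space (x : 'cV[C]_(2 * m)) :
  (x \in odd_space) = (tau *m x == - x).
Proof.
by rewrite memv_ker add_lfunE opp_lfunE scale_lfunE id_lfunE lfunE /=
  scaleN1r subr_eq0.
Qed.

End Graph.

(* Main.v *)
(* Since S x (e) = (2 / d_{s(e)}) (delta_t^* x)(s(e)) - x(-e), a fixed vector
   has x(e) + x(-e) depending only on s(e); this sum is invariant under
   reversal, hence constant on a connected graph, which gives (A), (B) and
   delta_t^* x = delta_s^* x, i.e. (C).  Among odd vectors both "fixed" and
   "harmonic" amount to delta_t^* x = 0, the cycle space.  Rank-nullity gives its
   dimension: odd vectors have dimension m, and delta_t^* maps them onto the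
   vectors of sum zero.  Finally, the chain of a walk is invariant under
   homotopy, and the chains of closed walks at v0 span the cycle space, so the
   chains of generators of pi_1 span it, and they are as many as its dimension. *)

Require Import Defs.
From mathcomp Require Import all_boot all_order all_algebra.
From mathcomp Require Import complex.
From mathcomp Require Import reals.

Set Implicit Arguments.
Unset Strict Implicit.

Import Order.TTheory GRing.Theory Num.Theory.
Local Open Scope ring_scope.
Local Open Scope sesquilinear_scope.

(** * Walks, connectedness and degrees *)

Section Walks.
Variables (n m : nat) (G : graph n m).
Notation dart := 'I_(2 * m).

Lemma tgt_erev (e : dart) : tgt G (erev G e) = src G e.
Proof. by rewrite /tgt erevK. Qed.

Lemma erev_inj : injective (erev G).
Proof. exact: inv_inj (erevK G). Qed.

Lemma walk_cat u v w p q : walk G u p v -> walk G v q w -> walk G u (p ++ q) w.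
Proof.
elim: p u => [|e p IHp] u /= => [/eqP-> //|/andP[-> pv] qw].
exact: IHp.
Qed.

Lemma walk_inv_walk u v p : walk G u p v -> walk G v (walk_inv G p) u.
Proof.
elim: p u => [|e p IHp] u /=; first by rewrite eq_sym.
case/andP=> /eqP ue /IHp pv.
rewrite /walk_inv /= rev_cons -cats1; apply: walk_cat pv _ => /=.
by rewrite tgt_erev ue !eqxx.
Qed.

Lemma connected_walk (G_connected : connected_graph G) u v :
  exists p, walk G u p v.
Proof.
have /connectP[s + ->] := G_connected u v.
elim: s u => [|w s IHs] u /=; first by exists [::] => /=.
case/andP=> /existsP[e /andP[ue /eqP ew]] /IHs[p pv].
by exists (e :: p); rewrite /= ue ew.
Qed.

Lemma connected_constant (G_connected : connected_graph G) (T : Type)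
    (f : 'I_n -> T) : (forall e, f (src G e) = f (tgt G e)) ->
  forall u v, f u = f v.
Proof.
move=> fE u v; have [p] := connected_walk G_connected u v.
elim: p u => [|e p IHp] u /= => [/eqP-> //|/andP[/eqP<- /IHp <-]].
exact: fE.
Qed.

(** A walk from [v] to the source of some dart is either empty, so [v] is that source, or begins
    with a dart leaving [v]. Either way the reversed dart enters [v]. *)
Lemma degree_gt0 (G_connected : connected_graph G) (m_gt0 : (0 < m)%N) v :
  (0 < degree G v)%N.
Proof.
have e0 : dart by exists 0; rewrite muln_gt0.
suff [e ev] : exists e, src G e = v.
  by apply/card_gt0P; exists (erev G e); rewrite inE tgt_erev ev.
have [[/eqP->|e p /andP[/eqP ev _]]] := connected_walk G_connected v (src G e0).
  by exists e0.
by exists e.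
Qed.

End Walks.

Section Chains.
Variables (n m : nat) (G : graph n m) (C : numClosedFieldType).
Notation dart := 'I_(2 * m).
Notation T := (tau G C).
Notation dts := (delta_t_star G C).
Notation dss := (delta_s_star G C).
Implicit Types (x : 'cV[C]_(2 * m)) (p q : seq dart).

(** * Entrywise action of the matrices on functions on darts *)

Lemma tau_mulE x e : (T *m x) e 0 = x (erev G e) 0.
Proof.
rewrite mxE (bigD1 (erev G e)) //= mxE erevK eqxx mul1r big1 ?addr0 // => f.
by rewrite mxE -(can_eq (erevK G)) erevK eq_sym => /negPf->; rewrite mul0r.
Qed.

Lemma tau_oddP x : T *m x = - x <-> forall e, x (erev G e) 0 = - x e 0.
Proof.
split=> [Tx e|xE]; first by rewrite -tau_mulE Tx mxE.
by apply/matrixP => e j; rewrite ord1 tau_mulE xE mxE.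
Qed.

Lemma delta_t_star_mulE x v : (dts *m x) v 0 = \sum_(e | tgt G e == v) x e 0.
Proof.
rewrite mxE [RHS]big_mkcond /=; apply: eq_bigr => e _.
by rewrite mxE eq_sym; case: eqP; rewrite ?mul1r ?mul0r.
Qed.

Lemma delta_s_star_tau : dss = dts *m T.
Proof.
apply/matrixP => v e; rewrite !mxE (bigD1 (erev G e)) //= !mxE eqxx mulr1.
rewrite tgt_erev big1 ?addr0 // => f.
by rewrite !mxE => /negPf->; rewrite mulr0.
Qed.

Lemma delta_s_star_mulE x v :
  (dss *m x) v 0 = \sum_(e | tgt G e == v) x (erev G e) 0.
Proof.
by rewrite delta_s_star_tau -mulmxA delta_t_star_mulE;
  under eq_bigr do rewrite tau_mulE.
Qed.

Lemma delta_t_mulE (y : 'cV[C]_n) e : (delta_t G C *m y) e 0 = y (tgt G e) 0.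
Proof.
rewrite mxE (bigD1 (tgt G e)) //= !mxE eqxx conjC1 mul1r big1 ?addr0 // => v.
by rewrite !mxE => /negPf->; rewrite conjC0 mul0r.
Qed.

Lemma delta_s_mulE (y : 'cV[C]_n) e : (delta_s G C *m y) e 0 = y (src G e) 0.
Proof.
rewrite mxE (bigD1 (src G e)) //= !mxE eqxx conjC1 mul1r big1 ?addr0 // => v.
by rewrite !mxE => /negPf->; rewrite conjC0 mul0r.
Qed.

Lemma bond_scattering_mulE x e :
  (bond_scattering G C *m x) e 0 =
    2 / (degree G (src G e))%:R * (dts *m x) (src G e) 0 - x (erev G e) 0.
Proof.
(* The subtracted term is spread over all darts entering [src G e], so that both sides become sums
   over the same darts and the backscattering correction -1 is matched termwise. *)
have -> : x (erev G e) 0 =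
    \sum_(f | tgt G f == src G e) (if f == erev G e then x f 0 else 0).
  rewrite (bigD1 (erev G e)) ?tgt_erev //= eqxx big1 ?addr0 // => f.
  by case/andP=> _ /negPf->.
rewrite delta_t_star_mulE mulr_sumr -sumrB mxE [RHS]big_mkcond /=.
apply: eq_bigr => f _; rewrite mxE; case: eqP => [->|_]; last by rewrite mul0r.
rewrite -(can_eq (erevK G)) erevK eq_sym; case: eqP => _; last by rewrite subr0.
by rewrite mulrBl mul1r.
Qed.

Lemma sum_darts x : \sum_e x e 0 = \sum_v (dts *m x) v 0.
Proof.
rewrite (partition_big (tgt G) xpredT) //=; apply: eq_bigr => v _.
by rewrite delta_t_star_mulE.
Qed.

(** Reindexing by [erev] shows that the sum equals its own opposite. *)
Lemma sum_odd x : T *m x = - x -> \sum_e x e 0 = 0.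
Proof.
move/tau_oddP=> xE; apply/eqP.
suff: (\sum_e x e 0) *+ 2 == 0 by rewrite mulrn_eq0.
rewrite mulr2n {1}(reindex_inj (@erev_inj _ _ G)) -big_split /=.
by rewrite big1 // => e _; rewrite xE addNr.
Qed.

(** * The cycle space (first homology over [C]) and chains of walks *)

Definition cycle_space : {vspace 'cV[C]_(2 * m)} :=
  (odd_space G C :&: lker (linfun (mulmx dts)))%VS.

Lemma mem_cycle_space x :
  (x \in cycle_space) = (T *m x == - x) && (dts *m x == 0).
Proof. by rewrite memv_cap mem_odd_space memv_ker lfunE. Qed.

(** The 1-chain of a walk, encoded as an odd function on darts; on a simple cycle it is the
    normalized vector of (E). *)
Definition chain p : 'cV[C]_(2 * m) :=
  \sum_(e <- p) (delta_mx e 0 - delta_mx (erev G e) 0).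

Lemma chain_nil : chain [::] = 0. Proof. exact: big_nil. Qed.

Lemma chain_cons e p :
  chain (e :: p) = delta_mx e 0 - delta_mx (erev G e) 0 + chain p.
Proof. exact: big_cons. Qed.

Lemma chain_cat p q : chain (p ++ q) = chain p + chain q.
Proof. exact: big_cat. Qed.

Lemma chain_inv p : chain (walk_inv G p) = - chain p.
Proof.
elim: p => [|e p IHp]; first by rewrite chain_nil oppr0.
rewrite /walk_inv /= rev_cons -cats1 chain_cat [chain (rev _)]IHp.
by rewrite !chain_cons chain_nil addr0 erevK opprD opprB addrC.
Qed.

(** A backtrack contributes a term and its opposite. *)
Lemma homotopic_chain u v p q : homotopic G u v p q -> chain p = chain q.
Proof.
elim=> // {p q} [p e q _|p q r _ -> _ ->] //.
by rewrite !chain_cat !chain_cons erevK -(opprB (delta_mx e 0)) addNKr.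
Qed.

Lemma chainE p e :
  chain p e 0 = (count_mem e p)%:R - (count_mem (erev G e) p)%:R.
Proof.
elim: p => [|f p IHp]; first by rewrite chain_nil mxE subrr.
rewrite chain_cons /= !natrD opprD addrACA -IHp !mxE !eqxx !andbT.
by rewrite [e == f]eq_sym -[e == _](can_eq (erevK G)) erevK [_ == f]eq_sym.
Qed.

Lemma chain_odd p : T *m chain p = - chain p.
Proof. by apply/tau_oddP => e; rewrite !chainE erevK opprB. Qed.

Lemma delta_t_star_delta e :
  dts *m delta_mx e 0 = delta_mx (tgt G e) 0 :> 'cV[C]_n.
Proof. by apply/matrixP => v j; rewrite ord1 -colE !mxE eqxx andbT. Qed.

Lemma chain_boundary u v p :
  walk G u p v -> dts *m chain p = delta_mx v 0 - delta_mx u 0.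
Proof.
elim: p u => [|e p IHp] u /=; first by move/eqP->; rewrite chain_nil mulmx0 subrr.
case/andP=> /eqP<- /IHp {}IHp; rewrite chain_cons mulmxDr mulmxBr IHp.
by rewrite !delta_t_star_delta tgt_erev addrC addrA subrK.
Qed.

(** Each dart of [p] occurs once and its reversal never, so the signed count [chainE] is 1 - 0;
    oddness gives the value on the reversal. *)
Lemma simple_chain p : uniq (p ++ map (erev G) p) ->
  (forall e, e \in p -> chain p e 0 = 1 /\ chain p (erev G e) 0 = -1) /\
  (forall e, e \notin p -> erev G e \notin p -> chain p e 0 = 0).
Proof.
rewrite cat_uniq => /and3P[p_uniq /hasPn p_rev _].
split=> [e ep|e /count_memPn ep /count_memPn rep]; last first.
  by rewrite chainE ep rep subrr.
have /count_memPn rep : erev G e \notin p by apply/p_rev/map_f.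
rewrite (tau_oddP _).1 ?chain_odd // chainE rep subr0 count_uniq_mem // ep.
by [].
Qed.

(** * Fixed, harmonic and odd vectors on a connected graph *)

Section Connected.
Hypothesis G_connected : connected_graph G.
Hypothesis m_gt0 : (0 < m)%N.

Let degree_neq0 v : (degree G v)%:R != 0 :> C.
Proof. by rewrite pnatr_eq0 -lt0n degree_gt0. Qed.

Let e0 : dart. Proof. by exists 0%N; rewrite muln_gt0. Qed.

Lemma degree_mx_unit : degree_mx G C \in unitmx.
Proof.
rewrite unitmxE det_diag unitfE; apply/prodf_neq0 => v _.
by rewrite mxE degree_neq0.
Qed.

Lemma harmonic_op_mulE x e :
  let flow v := (degree G v)%:R^-1 * ((dts - dss) *m x) v 0 in
  (harmonic_op G C *m x) e 0 = flow (tgt G e) - flow (src G e).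
Proof.
move=> flow; rewrite -!mulmxA;
set y := invmx (degree_mx G C) *m ((dts - dss) *m x).
have yE v : y v 0 = flow v.
  (* Multiplying back by the diagonal matrix determines [y] without computing the inverse. *)
  have : (degree_mx G C *m y) v 0 = ((dts - dss) *m x) v 0.
    by rewrite mulKVmx // degree_mx_unit.
  by rewrite mul_diag_mx 2!mxE /flow => <-; rewrite mulKf.
by rewrite mulmxBl mxE [in X in _ + X]mxE delta_t_mulE delta_s_mulE !yE.
Qed.

(** The second clause records the inflow at every vertex: it yields the balance of inflow and
    outflow, and zero inflow when [c] is 0. *)
Lemma fixed_symmetrization x : bond_scattering G C *m x = x ->
  exists c, (forall e, x e 0 + x (erev G e) 0 = c) /\
    forall v, 2 * (dts *m x) v 0 = c * (degree G v)%:R.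
Proof.
move=> Sx; pose g v := 2 / (degree G v)%:R * (dts *m x) v 0.
have gE e : x e 0 + x (erev G e) 0 = g (src G e).
  by rewrite -{1}Sx bond_scattering_mulE subrK.
have g_const := connected_constant G_connected (f := g).
exists (g (src G e0)).
have {}g_const u v : g u = g v.
  apply: g_const => e; rewrite -gE -[tgt G e]/(src G (erev G e)) -gE.
  by rewrite erevK addrC.
split=> [e|v]; first by rewrite gE; apply: g_const.
by rewrite (g_const _ v) /g mulrAC mulrVK ?unitfE.
Qed.

(** Summing [x e + x (erev e) = c] over the darts entering [v] gives inflow plus outflow equal to
    [c] times the degree, which is twice the inflow. *)
Lemma fixed_balanced x :
  bond_scattering G C *m x = x -> (dts - dss) *m x = 0.
Proof.
case/fixed_symmetrization=> c [xc cE]; apply/matrixP => v j; rewrite ord1.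
rewrite mulmxBl mxE [in X in _ + X]mxE [RHS]mxE; apply/eqP; rewrite subr_eq0.
apply/eqP/(addrI ((dts *m x) v 0)); rewrite -mulr2n -mulr_natl cE.
rewrite delta_t_star_mulE delta_s_star_mulE -big_split /=.
by rewrite (eq_bigr (fun=> c)) // sumr_const mulr_natr /degree cardsE.
Qed.

Lemma odd_fixedP x : T *m x = - x ->
  (bond_scattering G C *m x == x) = (dts *m x == 0).
Proof.
move=> xodd; apply/eqP/eqP => [/fixed_symmetrization[c [xc cE]]|dx0].
  have c0 : c = 0 by rewrite -(xc e0) ((tau_oddP x).1 xodd) subrr.
  apply/matrixP => v j; rewrite ord1 [RHS]mxE; apply/eqP.
  by move/eqP: (cE v); rewrite c0 mul0r mulf_eq0 pnatr_eq0.
apply/matrixP => e j; rewrite ord1 bond_scattering_mulE dx0 mxE mulr0 add0r.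
by rewrite ((tau_oddP x).1 xodd) opprK.
Qed.

(** Harmonicity makes net inflow divided by degree the same constant at all vertices. The total
    inflow of an odd vector is 0 while the total degree is positive, so this constant vanishes. *)
Lemma odd_harmonicP x : T *m x = - x ->
  (harmonic_op G C *m x == 0) = (dts *m x == 0).
Proof.
move=> xodd; have dE : (dts - dss) *m x = 2 *: (dts *m x).
  by rewrite mulmxBl delta_s_star_tau -mulmxA xodd mulmxN opprK scaler_nat mulr2n.
apply/eqP/eqP => [hx0|dx0]; last first.
  apply/matrixP => e j; rewrite ord1 harmonic_op_mulE dE dx0 scaler0 !mxE.
  by rewrite !mulr0 subrr.
pose g v := (degree G v)%:R^-1 * ((dts - dss) *m x) v 0.
have g_const u v : g u = g v.
  apply: (connected_constant G_connected) => e; apply/esym/eqP.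
  by rewrite -subr_eq0 -harmonic_op_mulE hx0 mxE.
set v0 := src G e0.
have gE v : 2 * (dts *m x) v 0 = g v0 * (degree G v)%:R.
  by rewrite (g_const v0 v) /g dE [in RHS]mxE mulrAC mulVf ?mul1r.
have : g v0 * \sum_v (degree G v)%:R = 0.
  rewrite mulr_sumr -(eq_bigr _ (fun v _ => gE v)) -mulr_sumr -sum_darts.
  by rewrite sum_odd ?mulr0.
move/eqP; rewrite mulf_eq0 -natr_sum pnatr_eq0 sum_nat_eq0.
rewrite [X in _ || X](_ : _ = false) ?orbF; last first.
  by apply/negP => /forallP/(_ v0); rewrite eqn0Ngt degree_gt0.
move=> /eqP g0; apply/matrixP => v j; rewrite ord1 [RHS]mxE; apply/eqP.
by move/eqP: (gE v); rewrite g0 mul0r mulf_eq0 pnatr_eq0.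
Qed.

Lemma fixed_odd_cycle_space :
  (fixed_space G C :&: odd_space G C)%VS = cycle_space.
Proof.
apply/vspaceP => x; rewrite [RHS]mem_cycle_space memv_cap.
rewrite [X in X && _]mem_fixed_space [X in _ && X]mem_odd_space.
by rewrite andbC; case: eqP => //= /odd_fixedP->.
Qed.

Lemma harmonic_odd_cycle_space :
  (harmonic_space G C :&: odd_space G C)%VS = cycle_space.
Proof.
apply/vspaceP => x; rewrite [RHS]mem_cycle_space memv_cap.
rewrite [X in X && _]mem_harmonic_space [X in _ && X]mem_odd_space.
by rewrite andbC; case: eqP => //= /odd_harmonicP->.
Qed.

(** * Dimension of the cycle space *)

Lemma dim_odd_space : \dim (odd_space G C) = m.
Proof.
(* [N] has the even vectors as kernel and the odd ones as image. Once these are shown to have equal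
   dimension, rank-nullity makes each half of 2m. *)
pose N : 'M[C]_(2 * m) := 1%:M - T.
have NE x : N *m x = x - T *m x by rewrite mulmxBl mul1mx.
have TK x : T *m (T *m x) = x.
  by apply/matrixP => e j; rewrite ord1 !tau_mulE erevK.
have evenE x : (x \in lker (linfun (mulmx N))) = (T *m x == x).
  by rewrite memv_ker lfunE /= NE subr_eq0 eq_sym.
have imgN : (linfun (mulmx N) @: fullv)%VS = odd_space G C.
  apply/vspaceP => x; apply/memv_imgP/idP => [[y _ ->]|].
    by rewrite mem_odd_space lfunE /= NE mulmxBr TK opprB.
  (* [N] doubles odd vectors. *)
  rewrite mem_odd_space => /eqP xodd; exists (2^-1 *: x); rewrite ?memvf //.
  rewrite lfunE /= NE -scalemxAr xodd scalerN opprK -scalerDl.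
  by rewrite -mulr2n -[_ *+ 2]mulr_natl mulfV ?scale1r // pnatr_eq0.
(* Multiplication by an orientation exchanges the odd and even vectors. *)
pose s (e : dart) : C := if (e < erev G e)%N then 1 else -1.
have s_erev e : s (erev G e) = - s e.
  rewrite /s erevK; case: ltngtP => [_|_|/val_inj ee]; rewrite ?opprK //.
  by case/eqP: (erev_neq G e).
have sK e : s e * s e = 1 by rewrite /s; case: ifP; rewrite ?mulrNN mulr1.
pose E : 'M[C]_(2 * m) := diag_mx (\row_e s e).
have EE x e : (E *m x) e 0 = s e * x e 0 by rewrite mul_diag_mx 2!mxE.
have EK x : E *m (E *m x) = x.
  by apply/matrixP => e j; rewrite ord1 !EE mulrA sK mul1r.
have TE x : T *m (E *m x) = - (E *m (T *m x)).
  apply/matrixP => e j; rewrite ord1 tau_mulE EE s_erev.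
  by rewrite [RHS]mxE EE tau_mulE mulNr.
have imgE : (linfun (mulmx E) @: odd_space G C)%VS = lker (linfun (mulmx N)).
  apply/vspaceP => x; rewrite evenE; apply/memv_imgP/eqP => [[y]|xeven].
    by rewrite mem_odd_space lfunE => /eqP yodd ->; rewrite /= TE yodd mulmxN opprK.
  by exists (E *m x); rewrite ?mem_odd_space ?lfunE /= ?EK // TE xeven.
have kerE : (odd_space G C :&: lker (linfun (mulmx E)) = 0)%VS.
  apply/eqP; rewrite -subv0; apply/subvP => x; rewrite memv_cap => /andP[_].
  by rewrite memv_ker lfunE /= => /eqP Ex0; rewrite -[x]EK Ex0 mulmx0 mem0v.
have := limg_ker_dim (linfun (mulmx N)) {: 'cV[C]_(2 * m)}.
rewrite capfv imgN -imgE (limg_dim_eq kerE) dimvf /dim /= muln1 addnn -mul2n.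
by move/eqP; rewrite eqn_pmul2l // => /eqP.
Qed.

(** A vector [y] of sum zero is the combination of the differences of vertex indicators at [v] and
    at a base vertex with weights [y v], and each difference is the boundary of the chain of a
    connecting walk. *)
Lemma boundary_odd_space :
  (linfun (mulmx dts) @: odd_space G C)%VS =
    lker (linfun (mulmx (const_mx 1 : 'rV[C]_n))).
Proof.
have sumE (y : 'cV[C]_n) : (const_mx 1 : 'rV[C]_n) *m y = (\sum_v y v 0)%:M.
  apply/matrixP => i j; rewrite !ord1 !mxE eqxx mulr1n.
  by apply: eq_bigr => v _; rewrite mxE mul1r.
apply/vspaceP => y; rewrite memv_ker [linfun (mulmx (const_mx 1)) _]lfunE /= sumE.
apply/memv_imgP/eqP => [[x + ->]|].
  by rewrite mem_odd_space lfunE /= -sum_darts => /eqP/sum_odd->; rewrite raddf0.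
move/matrixP/(_ 0 0); rewrite mxE mulr1n mxE => y_sum.
have [p pP] := fin_all_exists (connected_walk G_connected (src G e0)).
exists (\sum_v y v 0 *: chain (p v)).
  by apply: memv_suml => v _; rewrite memvZ // mem_odd_space chain_odd.
rewrite lfunE /= mulmx_sumr.
under eq_bigr => v _ do rewrite -scalemxAr (chain_boundary (pP v)) scalerBr.
rewrite sumrB -scaler_suml y_sum scale0r subr0 {1}[y]matrix_sum_delta.
by apply: eq_bigr => v _; rewrite big_ord1.
Qed.

Lemma dim_cycle_space : \dim cycle_space = betti1 n m.
Proof.
have := limg_ker_dim (linfun (mulmx (const_mx 1 : 'rV[C]_n))) {: 'cV[C]_n}.
have -> : (linfun (mulmx (const_mx 1 : 'rV[C]_n)) @: {: 'cV[C]_n} = fullv)%VS.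
  apply/vspaceP => z; rewrite memvf; apply/memv_imgP.
  exists (z 0 0 *: delta_mx (src G e0) 0); rewrite ?memvf // lfunE /=.
  by rewrite -scalemxAr -colE; apply/matrixP => i j; rewrite !ord1 !mxE mulr1.
rewrite capfv !dimvf /dim /= !muln1 => n_dim.
have := limg_ker_dim (linfun (mulmx dts)) (odd_space G C).
rewrite boundary_odd_space dim_odd_space -/cycle_space => m_dim.
(* The sum-zero vectors have dimension one less than n, so m + 1 is the dimension of the cycle space
   plus n and the truncated subtraction is exact. *)
by rewrite /betti1 -[X in (X + 1 - _)%N]m_dim -addnA n_dim addnK.
Qed.

Lemma cycle_space_closed_walks v0 x : x \in cycle_space ->
  exists2 p : dart -> seq dart, forall e, walk G v0 (p e) v0 &
    x = \sum_e (x e 0 / 2) *: chain (p e).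
Proof.
rewrite mem_cycle_space => /andP[/eqP xodd /eqP dx0].
have [h hP] := fin_all_exists (connected_walk G_connected v0).
(* Each dart is closed up through [v0] by the chosen walks [h]. The factor 1/2 in the statement
   compensates for every edge being counted by both of its darts. *)
exists (fun e => h (src G e) ++ e :: walk_inv G (h (tgt G e))) => [e|].
  apply: walk_cat (hP _) _; rewrite /= eqxx /=.
  exact: walk_inv_walk.
(* The chain of the closed walk is the antisymmetrization of [H]; since [x] is odd, the weighted sum
   reduces to that of [x e] times [H e]. *)
pose H e : 'cV[C]_(2 * m) := delta_mx e 0 - chain (h (tgt G e)).
have HE e : chain (h (src G e) ++ e :: walk_inv G (h (tgt G e))) =
    H e - H (erev G e).
  rewrite chain_cat chain_cons chain_inv /H tgt_erev opprB addrCA.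
  by rewrite [chain _ - _]addrC addrACA [- _ + chain _]addrC.
(* Grouped by target, the connecting walks are weighted by the inflow at each vertex, which is
   zero. *)
have flow_out : \sum_e x e 0 *: chain (h (tgt G e)) = 0.
  rewrite (partition_big (tgt G) xpredT) //= big1 // => v _.
  rewrite (eq_bigr (fun e => x e 0 *: chain (h v))) => [|e /eqP-> //].
  by rewrite -scaler_suml -delta_t_star_mulE dx0 mxE scale0r.
under eq_bigr => e _ do rewrite HE scalerBr.
rewrite sumrB [X in _ - X](reindex_inj (@erev_inj _ _ G)) /=.
under [X in _ - X]eq_bigr => e _ do
  rewrite ((tau_oddP x).1 xodd) mulNr scaleNr erevK.
rewrite sumrN opprK -big_split /=.
under eq_bigr => e _ do rewrite -scalerDl -splitr scalerBr.
rewrite sumrB flow_out subr0 {1}[x]matrix_sum_delta.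
by apply: eq_bigr => e _; rewrite big_ord1.
Qed.

Lemma chain_word_eval k (g : 'I_k -> seq dart) w :
  chain (word_eval G g w) =
    \sum_(a <- w) (-1) ^+ (a.2 : bool) *: chain (g a.1).
Proof.
elim: w => [|[j b] w IHw]; first by rewrite chain_nil big_nil.
rewrite /word_eval /= chain_cat big_cons [chain (flatten _)]IHw; congr (_ + _).
by case: b; rewrite /= ?chain_inv ?expr1 ?expr0 ?scaleN1r ?scale1r.
Qed.

(** Closed walks at [v0] are homotopic to words in the generators, so the chains of the generators
    span; a spanning family as long as the dimension is a basis. *)
Lemma independent_generators_basis (c : 'I_(betti1 n m) -> seq dart) :
  independent_generators G c ->
  basis_of cycle_space [tuple chain (c j) | j < betti1 n m].
Proof.
move=> [v0 [p [g_walk g_gen _]]]; set g := fun j => _ in g_walk g_gen.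
(* The connecting walk and its inverse cancel: conjugation is invisible in homology. *)
have gE j : chain (g j) = chain (c j).
  by rewrite !chain_cat chain_inv addrC subrK.
rewrite basisEdim size_tuple dim_cycle_space leqnn andbT.
apply/subvP => x /(cycle_space_closed_walks v0)[q q_walk ->].
apply: memv_suml => e _; apply: memvZ.
have [w /homotopic_chain->] := g_gen _ (q_walk e).
rewrite chain_word_eval; apply: memv_suml => -[j b] _; apply: memvZ.
by rewrite gE; apply/memv_span/mapP; exists j; rewrite ?mem_enum.
Qed.

End Connected.
End Chains.

Unset Implicit Arguments.

Theorem theorem2p2 (R : realType) (n m : nat) (G : graph n m)
    (G_connected : connected_graph G) (m_ge1 : (1 <= m)%N) :
  let S : 'M[R[i]]_(2 * m) := bond_scattering G R[i] in
  let T : 'M[R[i]]_(2 * m) := tau G R[i] in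
  let one : 'cV[R[i]]_(2 * m) := const_mx 1 in
  let dt := delta_t G R[i] in
  let ds := delta_s G R[i] in
  let dts := delta_t_star G R[i] in
  let dss := delta_s_star G R[i] in
  let D := degree_mx G R[i] in
  (* (A) *)
  (forall x : 'cV[R[i]]_(2 * m), S *m x = x -> T *m x = x ->
     exists a : R[i], x = a *: one) /\
  (* (B) *)
  (forall x : 'cV[R[i]]_(2 * m), S *m x = x -> one ^t* *m x = 0 ->
     T *m x = - x) /\
  (* (C) *)
  (forall x : 'cV[R[i]]_(2 * m), S *m x = x ->
     (dt - ds) *m invmx D *m (dts - dss) *m x = 0) /\
  (* (D) *)
  \dim (harmonic_space G R[i] :&: odd_space G R[i])%VS = betti1 n m /\
  (* (E) *)
  (forall c : 'I_(betti1 n m) -> seq 'I_(2 * m),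
     (forall j, is_cycle G (c j)) ->
     independent_generators G c ->
     exists X : (betti1 n m).-tuple 'cV[R[i]]_(2 * m),
       basis_of (fixed_space G R[i] :&: odd_space G R[i])%VS X /\
       forall j,
         (forall e, e \in c j ->
            tnth X j e 0 = 1 /\ tnth X j (erev G e) 0 = -1) /\
         (forall e, e \notin c j -> erev G e \notin c j ->
            tnth X j e 0 = 0)).
Proof.
move=> S T one dt ds dts dss D; split; [|split; [|split; [|split]]].
- move=> x Sx Tx.
  have [c [xc _]] := fixed_symmetrization G_connected m_ge1 Sx.
  (* For even [x] the symmetrization [c] is twice each entry. *)
  exists (c / 2); apply/matrixP => e j; rewrite ord1 !mxE mulr1 -(xc e).
  by rewrite -tau_mulE Tx mulrDl -splitr.
- move=> x Sx x_orth.
  have [c [xc _]] := fixed_symmetrization G_connected m_ge1 Sx.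
  have x_sum : \sum_e x e 0 = 0.
    have -> : \sum_e x e 0 = (one ^t* *m x) 0 0.
      by rewrite mxE; apply: eq_bigr => e _; rewrite !mxE conjC1 mul1r.
    by rewrite x_orth mxE.
  (* Summing the symmetrization over all darts gives twice the sum of [x], which is zero by
     orthogonality. *)
  have : c *+ (2 * m) = 0.
    rewrite -[in LHS](card_ord (2 * m)) -sumr_const -(eq_bigr _ (fun e _ => xc e)).
    move: (x_sum); rewrite (reindex_inj (@erev_inj _ _ G)) big_split /= => ->.
    by rewrite x_sum addr0.
  move/eqP; rewrite mulrn_eq0 muln_eq0 -[m == _]negbK -lt0n m_ge1 /= => /eqP c0.
  by apply/tau_oddP => e; apply/eqP; rewrite -addr_eq0 addrC xc c0.
- by move=> x Sx; rewrite -mulmxA fixed_balanced // mulmx0.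
- by rewrite harmonic_odd_cycle_space // dim_cycle_space.
move=> c c_cycle c_gen.
exists [tuple chain G R[i] (c j) | j < betti1 n m]; split.
  by rewrite fixed_odd_cycle_space //; apply: independent_generators_basis.
by move=> j; rewrite tnth_mktuple; apply: simple_chain; case: (c_cycle j).
Qed.
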